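(* Let $R$ be a commutative ring with identity, $M$ a torsion-free unital $R$-module and $N$ a proper submodule of $M$. Then the following statements are equivalent. (1) $N$ is a semi $r$-submodule of $M$. (2) $N$ is a semiprime submodule of $M$. (3) $N$ is a semi $n$-submodule of $M$.
   Context: $M$ is torsion-free if its only torsion element is $0$, where $m\in M$ is torsion if there exists a nonzero $r\in R$ with $rm=0$. $\sqrt{0}$ is the nilradical of $R$; $Ann_R(m)=\{r\in R: rm=0\}$ for $m\in M$; $Ann_M(r)=\{m\in M: rm=0\}$ for $r\in R$. Let $N$ be a proper submodule of $M$. $N$ is a semi $r$-submodule if whenever $r\in R$, $m\in M$ with $r^2m\in N$, $Ann_M(r)=0_M$ and $Ann_R(m)=0$, then $rm\in N$. $N$ is a semiprime submodule if whenever $r\in R$, $m\in M$ with $r^2m\in N$, then $rm\in N$. $N$ is a semi $n$-submodule if whenever $r\in R$, $m\in M$ with $r^{2}m\in N$, $r\notin\sqrt{0}$ and $Ann_R(m)=0$, then $rm\in N$. *)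

(* Defs.v *)
From mathcomp Require Import all_boot all_algebra.
From mathcomp Require Import boolp classical_sets.

Set Implicit Arguments.
Unset Strict Implicit.
Unset Printing Implicit Defensive.

Import GRing.Theory.
Local Open Scope ring_scope.
Local Open Scope classical_set_scope.

Section Definitions.
Variables (R : comPzRingType) (M : lmodType R).
Implicit Types (r : R) (m : M) (N : set M).

Definition torsion m : Prop := exists2 r, r <> 0 & r *: m = 0.

(* Over the zero ring nothing is torsion, not even 0: hence an implication rather
   than [set m | torsion m] = [set 0]. *)
Definition torsion_free : Prop := forall m : M, torsion m -> m = 0.

Definition nilradical : set R := [set r | exists2 k, (0 < k)%N & r ^+ k = 0].

Definition annR m : set R := [set r | r *: m = 0].

Definition annM r : set M := [set m | r *: m = 0].

Definition submodule N : Prop := submod_closed (mem N).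

Definition proper_submodule N : Prop := submodule N /\ N `<` setT.

Definition semi_r_submodule N : Prop :=
  proper_submodule N /\
  forall r m, N (r ^+ 2 *: m) -> annM r = [set 0] -> annR m = [set 0] ->
    N (r *: m).

Definition semiprime_submodule N : Prop :=
  proper_submodule N /\
  forall r m, N (r ^+ 2 *: m) -> N (r *: m).

Definition semi_n_submodule N : Prop :=
  proper_submodule N /\
  forall r m, N (r ^+ 2 *: m) -> ~ nilradical r -> annR m = [set 0] ->
    N (r *: m).

End Definitions.

(* Main.v *)
Require Import Defs.
From mathcomp Require Import all_boot all_algebra.
From mathcomp Require Import boolp classical_sets.

Import GRing.Theory.
Local Open Scope ring_scope.
Local Open Scope classical_set_scope.

(** In a torsion-free module, nonzero scalars and nonzero vectors have trivial annihilators
    ([annM_eq0], [annR_eq0]). So the side conditions of a semi r-submodule fail only if [r = 0] or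
    [m = 0], where [r *: m = 0] lies in [N] anyway; this gives semiprime. Semiprime implies semi n
    by weakening, and semi n returns to semi r because a nilpotent [r] with [annM r] trivial forces
    [m = 0]. *)

Lemma submodule0 (R : comPzRingType) (M : lmodType R) (N : set M) :
  submodule N -> N 0.
Proof. by case=> N0 _; rewrite -in_setE. Qed.

Lemma annM_eq0 (R : comPzRingType) (M : lmodType R) (r : R) :
  torsion_free M -> r <> 0 -> annM r = [set 0 : M].
Proof.
move=> hM r0; apply/seteqP; split=> [x rx0|_ ->]; last exact: scaler0.
by apply: hM; exists r.
Qed.

Lemma annR_eq0 (R : comPzRingType) (M : lmodType R) (m : M) :
  torsion_free M -> m <> 0 -> annR m = [set 0].
Proof.
move=> hM m0; apply/seteqP; split=> [r rm0|_ ->]; last exact: scale0r.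
by apply: contrapT => r0; apply/m0/hM; exists r.
Qed.

(** A trivial [annM r] means that [r] acts injectively, so factors of [r] can be cancelled one at a
    time. *)
Lemma annM_exp_eq0 (R : comPzRingType) (M : lmodType R) (r : R) (k : nat)
    (m : M) :
  annM r = [set 0 : M] -> r ^+ k *: m = 0 -> m = 0.
Proof.
move=> annr; elim: k => [|k IHk]; first by rewrite expr0 scale1r.
rewrite exprS -scalerA => rkm; apply: IHk.
by have: annM r (r ^+ k *: m) by []; rewrite annr.
Qed.

Theorem corollary1 (R : comPzRingType) (M : lmodType R) (N : set M)
    (hM : torsion_free M) (hN : proper_submodule N) :
  [<-> semi_r_submodule N; semiprime_submodule N; semi_n_submodule N].
Proof.
have N0 : N 0 by case: hN => /submodule0.
tfae.
- move=> [_ hr]; split=> // r m r2m.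
  have [->|r0] := pselect (r = 0); first by rewrite scale0r.
  have [->|m0] := pselect (m = 0); first by rewrite scaler0.
  by apply: hr => //; [exact: annM_eq0 | exact: annR_eq0].
- by move=> [_ hp]; split=> // r m r2m _ _; exact: hp.
(* If [r ^+ k = 0], then [r ^+ k] kills [m], and injectivity of [r] gives [m = 0]. *)
- move=> [_ hn]; split=> // r m r2m annr annm.
  have [[k _ rk0]|rnil] := pselect (nilradical r); last exact: hn.
  by rewrite (annM_exp_eq0 _ _ r k m annr) ?scaler0 // rk0 scale0r.
Qed.
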